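(* Let $X$ be a Banach space over $\mathbb{K}\in\{\mathbb{R},\mathbb{C}\}$ and let $Z:\mathbb{K}\times\mathbb{K}\to\mathbb{A}_X$ be a continuous cotranslation. The following statements are equivalent: (i) $t\mapsto Z(r,t)$ is derivable at $t=0$, for every $r\in\mathbb{K}$; (ii) $t\mapsto Z(r,t)$ is derivable (at every point), for every $r\in\mathbb{K}$. Moreover, each of them implies the following statements, which are equivalent to each other: (iii) $r\mapsto Z(r,t)$ is derivable at $r=0$, for every $t\in\mathbb{K}$; (iv) $r\mapsto Z(r,t)$ is derivable (at every point), for every $t\in\mathbb{K}$.
   Context: $\mathbb{B}_X$ is the Banach algebra of continuous linear operators $X\to X$ with the operator norm; $\mathbb{A}_X$ is the group of invertible elements of $\mathbb{B}_X$ with inverse in $\mathbb{B}_X$, with the subspace topology. A cotranslation is a map $Z:\mathbb{K}\times\mathbb{K}\to\mathbb{A}_X$ such that $Z(r,t+s)=Z(s+r,t)\,Z(r,s)$ for all $r,s,t\in\mathbb{K}$. A map $\psi:\mathbb{K}\to\mathbb{B}_X$ is derivable at $u$ if $\lim_{h\to0}\frac{\psi(u+h)-\psi(u)}{h}$ exists in $\mathbb{B}_X$. *)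

(* Defs.v *)
From HB Require Import structures.
From mathcomp Require Import all_boot all_order all_algebra.
From mathcomp Require Import complex.
From mathcomp Require Import all_classical all_reals all_analysis.

Set Implicit Arguments.
Unset Strict Implicit.
Unset Printing Implicit Defensive.

Import Order.TTheory GRing.Theory Num.Theory.
Import numFieldNormedType.Exports.

Local Open Scope classical_set_scope.
Local Open Scope ring_scope.

Variant scalar_kind := RealScalars | ComplexScalars.

Definition scalar_field (R : realType) (k : scalar_kind) : numFieldType :=
  match k with RealScalars => R | ComplexScalars => R[i] end.

(* MathComp norms of a K-normed module take values in K; [toR] and [ofR]
   translate between the nonnegative elements of K and those of R, so that the
   supremum defining the operator norm can be taken in R. *)
Definition toR (R : realType) (k : scalar_kind) : scalar_field R k -> R :=
  match k with RealScalars => id | ComplexScalars => @complex.Re R end.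

Definition ofR (R : realType) (k : scalar_kind) : R -> scalar_field R k :=
  match k with RealScalars => id | ComplexScalars => real_complex R end.

Arguments ofR {R} k.

Section ScalarTheory.
Variables (R : realType) (k : scalar_kind).

Lemma toRK (x : scalar_field R k) : 0 <= x -> ofR k (toR x) = x.
Proof.
by case: k x => //= x /ger0_real /RRe_real.
Qed.

Lemma ofRK (x : R) : toR (ofR k x) = x.
Proof. by case: k. Qed.

Lemma ofR_le (x y : R) : (ofR k x <= ofR k y) = (x <= y).
Proof. by case: k => //=; exact: lecR. Qed.

Lemma ofR0 : ofR k (0 : R) = 0.
Proof. by case: k. Qed.

End ScalarTheory.

Section BoundedOperators.
Variables (R : realType) (k : scalar_kind).
Local Notation K := (scalar_field R k).
Variable X : normedModType K.

Definition continuous_linear : {pred X -> X} :=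
  fun f => `[< linear f /\ continuous f >].

Record bop := Bop {
  bop_val :> X -> X;
  bopP : bop_val \in continuous_linear
}.

HB.instance Definition _ := [isSub for bop_val].
HB.instance Definition _ := [Choice of bop by <:].

Lemma continuous_linearP (f : X -> X) :
  reflect (linear f /\ continuous f) (f \in continuous_linear).
Proof. exact: asboolP. Qed.

Lemma continuous_linear_submod : submod_closed continuous_linear.
Proof.
split=> [|a f g /continuous_linearP[fl fc] /continuous_linearP[gl gc]].
  apply/continuous_linearP; split; last exact: cst_continuous.
  by move=> a u v; rewrite scaler0 addr0.
apply/continuous_linearP; split.
  move=> b u v; rewrite !fctE fl gl !scalerDr !scalerA -!addrA.
  by congr (_ + _); rewrite 1?mulrC // addrCA.
by move=> x; apply: cvgD; [apply: cvgZl_tmp; exact: fc|exact: gc].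
Qed.

HB.instance Definition _ :=
  GRing.isSubmodClosed.Build K (X -> X) continuous_linear
    continuous_linear_submod.
HB.instance Definition _ := [SubChoice_isSubLmodule of bop by <:].


Lemma bop_linear (f : bop) : linear f.
Proof. by have /continuous_linearP[] := bopP f. Qed.

HB.instance Definition _ (f : bop) :=
  GRing.isLinear.Build K X X *:%R f (bop_linear f).

Lemma bop_continuous (f : bop) : continuous f.
Proof. by have /continuous_linearP[] := bopP f. Qed.

Lemma bop_ext (f g : bop) : f =1 g -> f = g.
Proof. by move=> fg; apply/val_inj/funext. Qed.

Definition opnorm (f : bop) : K :=
  ofR k (sup [set toR `|f x| | x in [set x | `|x| <= 1]]).

Lemma opnorm_has_sup (f : bop) :
  has_sup [set toR `|f x| | x in [set x | `|x| <= 1]].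
Proof.
split; first by exists (toR `|f 0|), 0 => //=; rewrite normr0.
have /linear_boundedP/pinfty_ex_gt0[M M0 fM] :=
  (linear_bounded_continuous f).2 (@bop_continuous f).
exists (toR M) => _ [x /= x1 <-].
rewrite -(ofR_le k) !toRK ?normr_ge0 ?(ltW M0)//.
by apply: le_trans (fM x) _; rewrite ler_piMr // ltW.
Qed.

Lemma opnorm_ge0 (f : bop) : 0 <= opnorm f.
Proof.
rewrite /opnorm -(ofR0 R k) ofR_le.
have -> : (0 : R) = toR `|f 0|.
  by apply: (can_inj (@ofRK R k)); rewrite toRK // linear0 normr0 ofR0.
by apply: sup_upper_bound (opnorm_has_sup f) _ _; exists 0 => //=; rewrite normr0.
Qed.

Lemma opnormP (f : bop) (x : X) : `|f x| <= opnorm f * `|x|.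
Proof.
have [->|x0] := eqVneq x 0; first by rewrite linear0 !normr0 mulr0.
have nx : `|(`|x|^-1)| = `|x|^-1 by rewrite ger0_norm ?invr_ge0.
rewrite -ler_pdivrMr ?normr_gt0 // mulrC -nx -normrZ -linearZ.
rewrite -[leLHS]toRK // ofR_le.
apply: sup_upper_bound (opnorm_has_sup f) _ _.
exists (`|x|^-1 *: x) => //=.
by rewrite normrZ nx mulVf ?normr_eq0.
Qed.

Lemma opnorm_le (f : bop) (M : K) :
  0 <= M -> (forall x, `|f x| <= M * `|x|) -> opnorm f <= M.
Proof.
move=> M0 fM; rewrite -[M]toRK // ofR_le.
apply: ge_sup; first by case: (opnorm_has_sup f).
move=> _ [x /= x1 <-]; rewrite -(ofR_le k) !toRK //.
by apply: le_trans (fM x) _; rewrite ler_piMr.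
Qed.

Lemma ler_opnormD (f g : bop) : opnorm (f + g) <= opnorm f + opnorm g.
Proof.
apply: opnorm_le => [|x]; first by rewrite addr_ge0 ?opnorm_ge0.
rewrite mulrDl; apply: le_trans (ler_normD _ _) _.
by rewrite lerD ?opnormP.
Qed.

Let opnormZ_le (l : K) (f : bop) : opnorm (l *: f) <= `|l| * opnorm f.
Proof.
apply: opnorm_le => [|x]; first by rewrite mulr_ge0 ?opnorm_ge0.
have -> : `|(l *: f) x| = `|l| * `|f x| by rewrite -normrZ.
by rewrite -mulrA ler_wpM2l ?opnormP.
Qed.

Lemma opnormZ (l : K) (f : bop) : opnorm (l *: f) = `|l| * opnorm f.
Proof.
apply: le_anti; rewrite opnormZ_le /=.
have [->|l0] := eqVneq l 0; first by rewrite normr0 mul0r opnorm_ge0.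
rewrite -ler_pdivlMl ?normr_gt0 // -normfV.
by rewrite -{1}[f](scalerK l0) opnormZ_le.
Qed.

Lemma opnorm0_eq0 (f : bop) : opnorm f = 0 -> f = 0.
Proof.
move=> f0; apply: bop_ext => x; apply/eqP.
by rewrite -normr_le0; apply: le_trans (opnormP f x) _; rewrite f0 mul0r.
Qed.

HB.instance Definition _ :=
  Lmodule_isNormed.Build K bop ler_opnormD opnormZ opnorm0_eq0.

Lemma continuous_linear_id : idfun \in continuous_linear.
Proof. by apply/continuous_linearP; split => // x; exact: cvg_id. Qed.

Lemma continuous_linear_comp (f g : bop) : f \o g \in continuous_linear.
Proof.
apply/continuous_linearP; split=> [a u v|x]; first by rewrite /= !linearP.
by apply: continuous_comp; exact: bop_continuous.
Qed.

Definition bop_one : bop := Bop continuous_linear_id.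
Definition bop_mul (f g : bop) : bop := Bop (continuous_linear_comp f g).

Fact bop_mulA : associative bop_mul.
Proof. by move=> f g h; exact: bop_ext. Qed.

Fact bop_mul1l : left_id bop_one bop_mul.
Proof. by move=> f; exact: bop_ext. Qed.

Fact bop_mul1r : right_id bop_one bop_mul.
Proof. by move=> f; exact: bop_ext. Qed.

Fact bop_mulDl : left_distributive bop_mul +%R.
Proof. by move=> f g h; exact: bop_ext. Qed.

Fact bop_mulDr : right_distributive bop_mul +%R.
Proof. by move=> f g h; apply: bop_ext => x; exact: (linearD f). Qed.

HB.instance Definition _ := GRing.Zmodule_isPzRing.Build bop
  bop_mulA bop_mul1l bop_mul1r bop_mulDl bop_mulDr.

(* No [algType] instance: it would require 1 != 0, which fails when X = 0. *)
Fact bop_scaleAl (a : K) (f g : bop) : a *: (f * g) = (a *: f) * g.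
Proof. exact: bop_ext. Qed.

Fact bop_scaleAr (a : K) (f g : bop) : a *: (f * g) = f * (a *: g).
Proof. by apply: bop_ext => x; rewrite -[RHS]/(f (a *: g x)) linearZ. Qed.

Lemma bopM_norm (f g : bop) : `|f * g| <= `|f| * `|g|.
Proof.
apply: opnorm_le => [|x]; first by rewrite mulr_ge0.
apply: le_trans (opnormP f _) _.
by rewrite -mulrA ler_wpM2l ?opnorm_ge0 ?opnormP.
Qed.

(* As a type, this set carries the subspace topology. *)
Definition invertible : set bop :=
  [set f | exists g : bop, f * g = 1 /\ g * f = 1].

(* The product is taken in the ambient algebra. *)
Definition cotranslation (Z : K * K -> invertible) : Prop :=
  forall r s t : K,
    set_val (Z (r, t + s)) = set_val (Z (s + r, t)) * set_val (Z (r, s)) :> bop.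

End BoundedOperators.

Arguments invertible {R k} X _.

(* Main.v *)
(* The cocycle identity gives Z(u, t) = Z(0, t + u) Z(0, u)^-1 and, more
   generally, Z(u + h, t) = Z(h, t + u) Z(h, u)^-1, so each implication follows
   from the product and inverse rules for operator-valued functions. The inverse
   rule only needs the inverse to be continuous, and that is free here, since
   Z(r, s)^-1 = Z(s + r, -s) is again a value of the continuous map Z. *)
Require Import Defs.
From HB Require Import structures.
From mathcomp Require Import all_boot all_order all_algebra.
From mathcomp Require Import complex.
From mathcomp Require Import all_classical all_reals all_analysis.

Import Order.TTheory GRing.Theory Num.Theory.
Import numFieldNormedType.Exports.

Local Open Scope classical_set_scope.
Local Open Scope ring_scope.

(** Expanding around the limits writes the error as [(f x - a) * (g x - b)] plus two terms linear in
    the errors; by submultiplicativity of the operator norm each has norm tending to 0. *)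
Lemma cvg_bopM (R : realType) (k : scalar_kind)
    (X : normedModType (scalar_field R k)) (T : Type) (F : set_system T)
    (FF : Filter F) (f g : T -> bop X) (a b : bop X) :
  f @ F --> a -> g @ F --> b -> f x * g x @[x --> F] --> a * b.
Proof.
move=> fa gb.
have nfa : `|f x - a| @[x --> F] --> (0 : (scalar_field R k)^o).
  by apply/norm_cvg0P; rewrite -(subrr a); apply: cvgB => //; exact: cvg_cst.
have ngb : `|g x - b| @[x --> F] --> (0 : (scalar_field R k)^o).
  by apply/norm_cvg0P; rewrite -(subrr b); apply: cvgB => //; exact: cvg_cst.
have bound0 : `|f x - a| * `|g x - b| + (`|a| * `|g x - b| + `|f x - a| * `|b|)
    @[x --> F] --> (0 : (scalar_field R k)^o).
  have -> : (0 : (scalar_field R k)^o) = 0 * 0 + (`|a| * 0 + 0 * `|b|).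
    by rewrite !mulr0 mul0r !addr0.
  apply: cvgD; first exact: cvgM.
  by apply: cvgD; apply: cvgM => //; exact: cvg_cst.
apply/cvgrPdist_lt => e e0.
move/cvgr0Pnorm_lt : bound0 => /(_ e e0); apply: filterS => x; apply: le_lt_trans.
rewrite distrC [leRHS]ger0_norm ?addr_ge0 ?mulr_ge0//.
have -> : f x * g x - a * b =
    (f x - a) * (g x - b) + (a * (g x - b) + (f x - a) * b).
  by rewrite addrA -mulrDl subrK mulrBr mulrBl addrA subrK.
apply: (le_trans (ler_normD _ _)); rewrite lerD ?bopM_norm//.
by apply: (le_trans (ler_normD _ _)); rewrite lerD ?bopM_norm.
Qed.

Section Derivable.
Context {R : realType} {k : scalar_kind}.
Local Notation K := (scalar_field R k).
Context {X : normedModType K}.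
Implicit Types (f g : K -> bop X) (a : K).

(** Both sides have the same difference quotient. This moves the point of differentiation to 0,
    where (i) and (iii) apply. *)
Lemma derivable1_shift f a :
  derivable f a 1 <-> derivable (fun x => f (x + a)) 0 1.
Proof.
rewrite /derivable.
have -> // : (fun h : K => h^-1 *: (f (h *: 1 + a) - f a)) =
    (fun h : K => h^-1 *: (f (h *: 1 + 0 + a) - f (0 + a))).
by apply/funext => h; rewrite addr0 add0r.
Qed.

Lemma continuous_at_shift f a : {for a, continuous f} ->
  f (h *: 1 + a) @[h --> 0^'] --> f a.
Proof.
move=> fa; apply: cvg_within_filter.
have -> : (fun h : K => f (h *: 1 + a)) = f \o (fun h => h + a).
  by apply/funext => h; rewrite /= [_ *: _]mulr1.
apply: (@cvg_comp _ _ _ (fun h : K => h + a) f _ (nbhs a)); last exact: fa.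
by rewrite -[in nbhs a](add0r a); apply: cvgD; [exact: cvg_id|exact: cvg_cst].
Qed.

(** The increment is split with [g] at the moved point in one term and [f] at [a] in the other, so
    continuity of [g] is what the limit of the first term uses. The order of the factors is kept
    throughout. *)
Lemma derivable_bopM f g a : {for a, continuous g} ->
  derivable f a 1 -> derivable g a 1 -> derivable (fun x => f x * g x) a 1.
Proof.
move=> gc /cvg_ex[/= df fd] /cvg_ex[/= dg gd].
apply/cvg_ex; exists (df * g a + f a * dg).
have -> : (fun h : K => h^-1 *: (f (h *: 1 + a) * g (h *: 1 + a) - f a * g a)) =
    (fun h : K => h^-1 *: (f (h *: 1 + a) - f a) * g (h *: 1 + a)
      + f a * (h^-1 *: (g (h *: 1 + a) - g a))).
  apply/funext => h; rewrite -bop_scaleAl -bop_scaleAr -scalerDr.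
  by rewrite mulrBl mulrBr addrA subrK.
apply: cvgD; apply: cvg_bopM => //; last exact: cvg_cst.
exact: continuous_at_shift.
Qed.

(** The resolvent-type identity [g y - g a = - (g y * (f y - f a) * g a)] turns the quotient of [g]
    into that of [f] between two factors that converge, giving the derivative
    [- (g a * df * g a)]. *)
Lemma derivable_bopV f g a : {for a, continuous g} ->
  (forall x, f x * g x = 1) -> (forall x, g x * f x = 1) ->
  derivable f a 1 -> derivable g a 1.
Proof.
move=> gc fgK gfK /cvg_ex[/= df fd].
apply/cvg_ex; exists (- (g a * df * g a)).
have -> : (fun h : K => h^-1 *: (g (h *: 1 + a) - g a)) =
    (fun h : K => - (g (h *: 1 + a) * (h^-1 *: (f (h *: 1 + a) - f a)) * g a)).
  apply/funext => h; rewrite -bop_scaleAr -bop_scaleAl -scalerN.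
  by rewrite mulrBr mulrBl gfK mul1r -mulrA fgK mulr1 opprB.
apply: cvgN; apply: cvg_bopM; last exact: cvg_cst.
by apply: cvg_bopM => //; exact: continuous_at_shift.
Qed.

End Derivable.

Section Cotranslation.
Context {R : realType} {k : scalar_kind}.
Local Notation K := (scalar_field R k).
Context {X : normedModType K} {Z : K * K -> invertible X}.
Local Notation z r t := (set_val (Z (r, t)) : bop X).
Hypotheses (Zc : continuous Z) (Zcot : cotranslation Z).

Lemma cotranslation_cont (a b : K -> K) :
  continuous a -> continuous b -> continuous (fun x => z (a x) (b x)).
Proof.
move=> ac bc x.
apply: (@continuous_comp _ _ _ (fun x => Z (a x, b x)) set_val); last first.
  exact: initial_continuous.
apply: (@continuous_comp _ _ _ (fun x => (a x, b x)) Z); last exact: Zc.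
exact: (cvg_pair (ac x) (bc x)).
Qed.

(** The cocycle identity at times 0 and 0 makes this value idempotent, and an invertible idempotent
    is 1. *)
Lemma cotranslation0 r : z r 0 = 1.
Proof.
have /= := Zcot r 0 0; rewrite !add0r => zz.
have [g [_ gz]] : invertible X (z r 0) by exact: set_valP.
by rewrite -[LHS]mul1r -gz -mulrA -zz gz.
Qed.

Lemma cotranslationVl r s : z (s + r) (- s) * z r s = 1.
Proof. by rewrite -Zcot addNr cotranslation0. Qed.

(** This is the left inverse identity for the reversed motion, which starts at [s + r] and returns
    to [r] after time [- s]. *)
Lemma cotranslationVr r s : z r s * z (s + r) (- s) = 1.
Proof. by have := cotranslationVl (s + r) (- s); rewrite opprK addKr. Qed.

Lemma cotranslationD r s t : z (s + r) t = z r (t + s) * z (s + r) (- s).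
Proof. by rewrite Zcot -mulrA cotranslationVr mulr1. Qed.

End Cotranslation.

Theorem corollary4p7 (R : realType) (k : scalar_kind)
    (X : completeNormedModType (scalar_field R k))
    (Z : scalar_field R k * scalar_field R k -> invertible X) :
  continuous Z -> cotranslation Z ->
  let i := forall r : scalar_field R k,
    derivable (fun t : scalar_field R k => set_val (Z (r, t)) : bop X) 0 1 in
  let ii := forall r u : scalar_field R k,
    derivable (fun t : scalar_field R k => set_val (Z (r, t)) : bop X) u 1 in
  let iii := forall t : scalar_field R k,
    derivable (fun r : scalar_field R k => set_val (Z (r, t)) : bop X) 0 1 in
  let iv := forall t u : scalar_field R k,
    derivable (fun r : scalar_field R k => set_val (Z (r, t)) : bop X) u 1 in
  [/\ i <-> ii, iii <-> iv & i \/ ii -> iii /\ iv].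
Proof.
move=> Zc Zcot i ii iii iv.
have addc (c : scalar_field R k) : continuous (fun x => x + c).
  by move=> x; apply: (cvgD cvg_id); exact: cvg_cst.
have cstc (c : scalar_field R k) : continuous (fun _ : scalar_field R k => c).
  exact: cst_continuous.
have idc : continuous (fun x : scalar_field R k => x) by move=> x; exact: cvg_id.
have zc := cotranslation_cont Zc.
have i_ii : i -> ii.
  move=> hi r u; apply/derivable1_shift.
  (* After the shift, the curve is [Z (u + r, x)] times the constant [Z (r, u)], so (i) is used at
     the point [u + r]. *)
  under eq_fun do rewrite Zcot.
  by apply: derivable_bopM; [exact: cst_continuous|exact: hi|exact: derivable_cst].
have iii_iv : iii -> iv.
  move=> hiii t u; apply/derivable1_shift.
  (* The curve becomes [Z (x, t + u)] times the inverse of [Z (x, u)]; (iii) is used at the times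
     [t + u] and [u]. *)
  under eq_fun do rewrite addrC (cotranslationD Zcot).
  have Vc : continuous (fun x => set_val (Z (u + x, - u)) : bop X).
    by under eq_fun do rewrite addrC; exact: (zc _ _ (addc u) (cstc (- u))).
  apply: derivable_bopM; [exact: Vc|exact: hiii|].
  apply: derivable_bopV (hiii u); first exact: Vc.
    by move=> x; exact: cotranslationVr.
  by move=> x; exact: cotranslationVl.
have ii_iii : ii -> iii.
  move=> hii t.
  (* Both factors come from the single curve [Z (0, _)]: the first is its translate by [t], the
     second its pointwise inverse. Hence (ii) is needed at the points [t] and 0. *)
  have -> : (fun r => set_val (Z (r, t)) : bop X) =
      (fun r => set_val (Z (0, r + t)) * set_val (Z (r, - r))).
    by apply/funext => r; have := cotranslationD Zcot 0 r t; rewrite addr0 addrC.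
  have Vc : continuous (fun r => set_val (Z (r, - r)) : bop X).
    by apply: (zc _ -%R idc); exact: opp_continuous.
  apply: derivable_bopM; first exact: Vc.
    by have /derivable1_shift := hii 0 t.
  apply: derivable_bopV (hii 0 0); first exact: Vc.
    by move=> x; have := cotranslationVr Zcot 0 x; rewrite addr0.
  by move=> x; have := cotranslationVl Zcot 0 x; rewrite addr0.
split.
- by split=> [|hii r]; [exact: i_ii|exact: hii].
- by split=> [|hiv t]; [exact: iii_iv|exact: hiv].
- move=> i_or_ii; suff hiii : iii by split; [exact: hiii|exact: iii_iv].
  by apply: ii_iii; case: i_or_ii => [/i_ii|].
Qed.
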